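(* The classes $\mathbf{CRL}$, $\mathbf{biCRL}$, $\mathbf{mCRL}$, $\mathbf{jCRL}$, $\mathbf{DL}$ of bounded distributive lattices satisfy $$\mathbf{CRL}\subsetneq \mathbf{biCRL}=\mathbf{mCRL}\cap\mathbf{jCRL}\subsetneq \mathbf{mCRL}\neq\mathbf{jCRL}\subsetneq\mathbf{DL},$$ where all the marked inclusions are proper.
   Context: A representation of a bounded distributive lattice $L$ is a lattice embedding $h\colon L\to\wp(X)$ for some set $X$, where $\wp(X)$ is regarded as a ring of sets under union and intersection; representations are assumed irredundant, i.e. for every $x\in X$ there is $a\in L$ with $x\in h(a)$. A lattice map $f\colon L_1\to L_2$ is meet-complete if for all $S\subseteq L_1$ such that $\bigwedge S$ exists in $L_1$ we have $f(\bigwedge_{L_1}S)=\bigwedge_{L_2}f[S]$; join-complete is defined dually; a map is complete if it is both meet-complete and join-complete. $\mathbf{DL}$ is the class of all bounded distributive lattices. $\mathbf{mCRL}$, $\mathbf{jCRL}$ and $\mathbf{CRL}$ are the classes of bounded distributive lattices having a meet-complete representation, a join-complete representation, and a complete representation, respectively. $\mathbf{biCRL}$ is the class of bounded distributive lattices having both a meet-complete representation and a (possibly different) join-complete representation. *)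

(* Defs.v *)
From mathcomp Require Import all_boot all_order.
From mathcomp Require Import boolp classical_sets.

Set Implicit Arguments.
Unset Strict Implicit.
Unset Printing Implicit Defensive.

Local Open Scope classical_set_scope.

(* [infimums S a] says that the meet of [S] exists and is [a]; no other
   condition is put on [S], so the empty meet (the top) and the empty join
   (the bottom) are included. *)
Definition meet_complete (d1 d2 : Order.disp_t) (L1 : latticeType d1)
    (L2 : latticeType d2) (f : L1 -> L2) : Prop :=
  forall (S : set L1) (a : L1), infimums S a -> infimums (f @` S) (f a).

Definition join_complete (d1 d2 : Order.disp_t) (L1 : latticeType d1)
    (L2 : latticeType d2) (f : L1 -> L2) : Prop :=
  forall (S : set L1) (a : L1), supremums S a -> supremums (f @` S) (f a).

Definition complete_map (d1 d2 : Order.disp_t) (L1 : latticeType d1)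
    (L2 : latticeType d2) (f : L1 -> L2) : Prop :=
  meet_complete f /\ join_complete f.

(* [set X] carries its library lattice structure: inclusion, union,
   intersection. A lattice morphism need not preserve the bounds. *)
Record representation (d : Order.disp_t) (L : tbDistrLatticeType d) := {
  rep_base : Type;
  rep_map :> {lmorphism L -> set rep_base};
  rep_inj : injective rep_map;
  rep_irredundant : forall x : rep_base, exists a : L, rep_map a x
}.

(* A [set] of lattices would be universe-inconsistent (as [set X] is itself a
   lattice), hence dedicated notions of class, inclusion and equality. The
   display [d] is only a tag for notations: a class ranges over all of them. *)
Definition bdl_class := forall d : Order.disp_t, tbDistrLatticeType d -> Prop.

Definition subclass (A B : bdl_class) : Prop :=
  forall (d : Order.disp_t) (L : tbDistrLatticeType d), A d L -> B d L.

Definition proper_subclass (A B : bdl_class) : Prop :=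
  subclass A B /\ ~ subclass B A.

Definition eq_class (A B : bdl_class) : Prop :=
  forall (d : Order.disp_t) (L : tbDistrLatticeType d), A d L <-> B d L.

Definition inter_class (A B : bdl_class) : bdl_class :=
  fun d L => A d L /\ B d L.

Definition DL : bdl_class := fun d L => True.

Definition mCRL : bdl_class :=
  fun d L => exists h : representation L, meet_complete h.

Definition jCRL : bdl_class :=
  fun d L => exists h : representation L, join_complete h.

Definition CRL : bdl_class :=
  fun d L => exists h : representation L, complete_map h.

Definition biCRL : bdl_class :=
  fun d L => (exists h : representation L, meet_complete h) /\
             (exists k : representation L, join_complete k).

(* Main.v *)
(** A point [x] of a representation [h] gives the prime filter of all [a] with
    [x] in [h a]; meet-completeness says that these filters are closed under
    existing meets, join-completeness that they are completely prime, and
    injectivity that they separate elements.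

    The chain [-oo, +oo] separates CRL from biCRL: principal filters give a
    meet-complete representation and their strict versions a join-complete one,
    but a proper filter closed under meets has a least element [c], and [c] is
    the join of the elements strictly below it.

    The natural numbers under divisibility separate mCRL from jCRL: the filters
    generated by prime powers give a meet-complete representation. The top, 0,
    is both the join of the powers of 2 and that of the powers of 3, so a
    nonempty completely prime filter contains coprime numbers, hence also the
    bottom element 1. *)

From HB Require Import structures.
From mathcomp Require Import all_boot all_order ssralg ssrnum.
From mathcomp Require Import boolp classical_sets reals constructive_ereal ereal.
From mathcomp Require Import Rstruct.
Require Import Defs.

Set Implicit Arguments.
Unset Strict Implicit.
Unset Printing Implicit Defensive.

Import Order.TTheory GRing.Theory Num.Theory.
Local Open Scope classical_set_scope.
Local Open Scope order_scope.

(** * Meet-complete representations by principal prime filters *)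

Section JoinPrimeRepresentation.
Context (d : Order.disp_t) (L : tbDistrLatticeType d).

(** [\bot] counts as join-prime: its filter is the whole lattice, a legitimate point because a
    representation may send [\bot] to a nonempty set. *)
Definition join_prime (q : L) : Prop :=
  forall a b : L, q <= a `|` b -> q <= a \/ q <= b.

Definition join_primes_below (a : L) : set {q : L | join_prime q} :=
  [set q | sval q <= a].

Lemma join_primes_below_mono : {homo join_primes_below : a b / a <= b}.
Proof. by move=> a b ab; apply/subsetPset => q /le_trans; apply. Qed.

Lemma join_primes_belowI : {morph join_primes_below : a b / a `&` b}.
Proof.
move=> a b; rewrite meetEset; apply/seteqP; split=> q;
  by rewrite /join_primes_below /= lexI => /andP.
Qed.

Lemma join_primes_belowU : {morph join_primes_below : a b / a `|` b}.
Proof.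
move=> a b; rewrite joinEset; apply/seteqP; split=> q;
    rewrite /join_primes_below /=.
  exact: (svalP q).
by case=> qle; [exact: lexUl | exact: lexUr].
Qed.

HB.instance Definition _ := Order.isOrderMorphism.Build _ _ _ _
  join_primes_below join_primes_below_mono.
HB.instance Definition _ := Order.isMeetLatticeMorphism.Build _ _ _ _
  join_primes_below join_primes_belowI.
HB.instance Definition _ := Order.isJoinLatticeMorphism.Build _ _ _ _
  join_primes_below join_primes_belowU.

(** The elements above [q] form a filter, prime when [q] is join-prime, and closed under every
    existing meet since a lower bound of a set lies below its infimum. The hypothesis gives
    injectivity. *)
Lemma mCRL_join_prime :
  (forall a b : L, (forall q, join_prime q -> q <= a -> q <= b) -> a <= b) ->
  mCRL L.
Proof.
move=> sep.
have inj : injective join_primes_below.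
  suff le a b : join_primes_below a = join_primes_below b -> a <= b.
    by move=> a b E; apply/le_anti; rewrite !le.
  move=> E; apply: sep => q Pq qa.
  have : join_primes_below a (exist _ q Pq) by [].
  by rewrite E.
have irr x : exists a, join_primes_below a x by exists \top; exact: lex1.
exists (@Build_representation _ _ _ join_primes_below inj irr).
move=> S a [lbS glbS]; split=> /=.
  move=> _ [s Ss <-]; apply/subsetPset => q; move: (lbS s Ss).
  by move=> /[swap]; exact: le_trans.
move=> B lbB; apply/subsetPset => q Bq; apply: glbS => s Ss.
by have /subsetPset/(_ q Bq) : B <= join_primes_below s by apply: lbB; exists s.
Qed.

End JoinPrimeRepresentation.

(** * Join-complete representations by complements of principal prime ideals *)

Section MeetPrimeRepresentation.
Context (d : Order.disp_t) (L : tbDistrLatticeType d).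

(** The condition [q < \top] puts [\top] in the filter of elements not below [q], which yields
    irredundance. *)
Definition meet_prime (q : L) : Prop :=
  q < \top /\ forall a b : L, a `&` b <= q -> a <= q \/ b <= q.

Definition meet_primes_not_above (a : L) : set {q : L | meet_prime q} :=
  [set q | ~ (a <= sval q)].

Lemma meet_primes_not_above_mono : {homo meet_primes_not_above : a b / a <= b}.
Proof.
by move=> a b ab; apply/subsetPset => q naq bq; apply: naq; exact: le_trans bq.
Qed.

Lemma meet_primes_not_aboveI : {morph meet_primes_not_above : a b / a `&` b}.
Proof.
move=> a b; rewrite meetEset; apply/seteqP; split=> q;
    rewrite /meet_primes_not_above /=.
  by move=> H; split=> le; apply: H; [exact: leIxl | exact: leIxr].
by move=> [na nb] /(proj2 (svalP q)) [].
Qed.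

Lemma meet_primes_not_aboveU : {morph meet_primes_not_above : a b / a `|` b}.
Proof.
move=> a b; rewrite joinEset; apply/seteqP; split=> q;
    rewrite /meet_primes_not_above /= leUx.
  by move=> /negP; rewrite negb_and => /orP[]/negP; [left|right].
by move=> [] n /andP[].
Qed.

HB.instance Definition _ := Order.isOrderMorphism.Build _ _ _ _
  meet_primes_not_above meet_primes_not_above_mono.
HB.instance Definition _ := Order.isMeetLatticeMorphism.Build _ _ _ _
  meet_primes_not_above meet_primes_not_aboveI.
HB.instance Definition _ := Order.isJoinLatticeMorphism.Build _ _ _ _
  meet_primes_not_above meet_primes_not_aboveU.

(** If all elements of a set are below [q], so is their join; hence the filter of elements not below
    [q] is completely prime. *)
Lemma jCRL_meet_prime :
  (forall a b : L, (forall q, meet_prime q -> b <= q -> a <= q) -> a <= b) ->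
  jCRL L.
Proof.
move=> sep.
have inj : injective meet_primes_not_above.
  suff le a b : meet_primes_not_above a = meet_primes_not_above b -> a <= b.
    by move=> a b E; apply/le_anti; rewrite !le.
  move=> E; apply: sep => q Pq bq; apply: contrapT => naq.
  have : meet_primes_not_above a (exist _ q Pq) by [].
  by rewrite E; exact.
have irr x : exists a, meet_primes_not_above a x.
  by exists \top; rewrite /meet_primes_not_above /= (lt_geF (proj1 (svalP x))).
exists (@Build_representation _ _ _ meet_primes_not_above inj irr).
move=> S a [ubS lubS]; split=> /=.
  move=> _ [s Ss <-]; apply/subsetPset => q nsq aq; apply: nsq.
  exact: le_trans (ubS s Ss) aq.
move=> B ubB; apply/subsetPset => q naq; apply: contrapT => nBq; apply: naq.
apply: lubS => s Ss; apply: contrapT => nsq; apply: nBq.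
by have /subsetPset/(_ q nsq) : meet_primes_not_above s <= B
  by apply: ubB; exists s.
Qed.

End MeetPrimeRepresentation.

(** * Filters attached to the points of a representation *)

Section RepresentationPoints.
Context (d : Order.disp_t) (L : tbDistrLatticeType d) (h : representation L).

Lemma rep_mono (a b : L) (x : rep_base h) : a <= b -> h a x -> h b x.
Proof. by move=> /meet_idPl <-; rewrite omorphI => -[]. Qed.

(** The order is an equation between meets, so an injective lattice morphism reflects it. *)
Lemma rep_sep (a b : L) : ~~ (a <= b) -> exists2 x, h a x & ~ h b x.
Proof.
move=> nab; apply: contrapT => H; move/negP: nab; apply.
apply/meet_idPl/(@rep_inj _ _ h); rewrite omorphI; apply/setIidPl => x ax.
by apply: contrapT => nbx; apply: H; exists x.
Qed.

Lemma meet_complete_rep (S : set L) (a : L) (x : rep_base h) :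
  meet_complete h -> infimums S a -> (forall s, S s -> h s x) -> h a x.
Proof.
move=> hm /hm[_ glb] Sx; have /subsetPset/(_ x erefl) // : [set x] <= h a.
by apply: glb => _ [s Ss <-]; apply/subsetPset => _ ->; exact: Sx.
Qed.

Lemma join_complete_rep (S : set L) (a : L) (x : rep_base h) :
  join_complete h -> supremums S a -> h a x -> exists2 s, S s & h s x.
Proof.
move=> hj /hj[_ lub] ax.
have /subsetPset/(_ x ax)[s Ss sx] : h a <= \bigcup_(s in S) h s;
  last by exists s.
by apply: lub => _ [s Ss <-]; apply/subsetPset => y sy; exists s.
Qed.

End RepresentationPoints.

(** * The extended real line lies in biCRL but not in CRL *)

Section ExtendedReals.
Context (R : realType).
Implicit Types x y c : \bar R.

Lemma ereal_dense x y : x < y -> exists2 z, x < z & z < y.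
Proof.
case: x y => [x||] [y||] //; rewrite ?ltxx ?lte_fin => xy.
- have [l r] := midf_lt xy; exists ((x + y) / 2)%:E%R; rewrite lte_fin //.
- by exists (x + 1)%:E%R; rewrite ?ltry// lte_fin ltrDl.
- by exists (y - 1)%:E%R; rewrite ?ltNyr// lte_fin ltrBlDr ltrDl.
- by exists 0%:E%R; rewrite ?ltNyr ?ltry.
Qed.

(** This follows from density of the order. At minus infinity the set is empty and its supremum is
    the bottom, so that case needs no separate treatment. *)
Lemma ereal_supremums_lt c : supremums [set x | x < c] c.
Proof.
split=> [x /ltW //|u ubu]; rewrite leNgt; apply/negP => /ereal_dense[z uz zc].
by have := lt_le_trans uz (ubu z zc); rewrite ltxx.
Qed.

Lemma ereal_infimums (S : set \bar R) : infimums S (ereal_inf S).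
Proof.
by split; [exact: ereal_inf_lbound | move=> y; exact: le_ereal_inf_tmp].
Qed.

Lemma ereal_mCRL : mCRL (\bar R).
Proof.
(* In a chain every element is join-prime, so [a] itself serves as [q]. *)
apply: mCRL_join_prime => a b; apply=> // x y.
by rewrite joinEtotal le_max => /orP.
Qed.

Lemma ereal_jCRL : jCRL (\bar R).
Proof.
apply: jCRL_meet_prime => a b sep; have [->|b_neq] := eqVneq b \top.
  exact: lex1.
apply: sep => //; split; first by rewrite lt_neqAle b_neq lex1.
by move=> x y; rewrite meetEtotal ge_min => /orP.
Qed.

Lemma ereal_not_CRL : ~ CRL (\bar R).
Proof.
move=> [h [hm hj]].
have [x _ nbx] : exists2 x, h \top x & ~ h \bot x.
  by apply: rep_sep; rewrite -ltNge.
pose c := ereal_inf [set a | h a x].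
have cx : h c x by apply: (meet_complete_rep hm (ereal_infimums _)).
have [s sc sx] := join_complete_rep hj (ereal_supremums_lt c) cx.
have : c <= s by exact: ereal_inf_lbound.
by rewrite leNgt sc.
Qed.

End ExtendedReals.

(** * The divisibility lattice lies in mCRL but not in jCRL *)

Section Divisibility.

(** The [p]-adic valuation of an lcm is the maximum of the two valuations. *)
Lemma pfactor_join_prime (p k : nat) :
  prime p -> @join_prime _ natdvd (p ^ k)%N.
Proof.
move=> p_pr a b; rewrite -[(_ `|` _)]/(lcmn a b) !dvdEnat.
(* Zero is divisible by everything, whereas [logn p 0] is 0 by convention, so it is treated
   apart. *)
case: (posnP a) => [->|a0]; first by left.
case: (posnP b) => [->|b0]; first by right.
rewrite !pfactor_dvdn ?lcmn_gt0 ?a0// logn_lcm// leq_max.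
by move=> /orP.
Qed.

Lemma natdvd_mCRL : mCRL natdvd.
Proof.
apply: mCRL_join_prime => a b sep; rewrite dvdEnat.
have {}sep p k : prime p -> (p ^ k %| a -> p ^ k %| b)%N.
  by move=> /(pfactor_join_prime (k := k)) /sep; rewrite !dvdEnat.
case: (posnP b) => [->//|b0].
case: (posnP a) => [a0|a0].
  (* [2 ^ b] divides 0 but, exceeding the nonzero [b], cannot divide it. *)
  have := sep 2 b isT; rewrite a0 => /(_ (dvdn0 _)) /(dvdn_leq b0).
  by rewrite leqNgt ltn_expl.
apply/dvdn_partP => // p; rewrite mem_primes => /andP[p_pr _].
by rewrite p_part; apply: sep p_pr _; exact: pfactor_dvdnn.
Qed.

Lemma natdvd_supremums_pow (p : nat) : (1 < p)%N ->
  @supremums _ natdvd [set (p ^ k)%N | k in setT] \top.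
Proof.
move=> p1; split=> [n _|u ubu]; first exact: lex1.
(* A nonzero [u] is smaller than [p ^ u], so only 0, the top, is a common multiple of all the
   powers. *)
suff -> : u = 0%N by [].
apply/eqP; rewrite -leqn0 leqNgt; apply/negP => u0.
have : (p ^ u %| u)%N by apply: ubu; exists u.
by move=> /(dvdn_leq u0); rewrite leqNgt ltn_expl.
Qed.

Lemma natdvd_not_jCRL : ~ jCRL natdvd.
Proof.
move=> [h hj].
have [x tx n1x] : exists2 x, h \top x & ~ h \bot x by exact: rep_sep.
have [_ [k _ <-] kx] :=
  join_complete_rep hj (natdvd_supremums_pow (isT : 1 < 2)%N) tx.
have [_ [l _ <-] lx] :=
  join_complete_rep hj (natdvd_supremums_pow (isT : 1 < 3)%N) tx.
apply: n1x; have -> : \bot = ((2 ^ k)%N : natdvd) `&` ((3 ^ l)%N : natdvd).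
  by apply/esym/eqP; rewrite -[_ == _]/(coprime _ _) coprimeXl ?coprimeXr.
by rewrite omorphI.
Qed.

End Divisibility.

Theorem mainTheorem1 :
  proper_subclass CRL biCRL /\
  eq_class biCRL (inter_class mCRL jCRL) /\
  proper_subclass (inter_class mCRL jCRL) mCRL /\
  ~ eq_class mCRL jCRL /\
  proper_subclass jCRL DL.
Proof.
split; last split; last split; last split.
- split=> [d L [h [hm hj]]|sub]; first by split; exists h.
  (* The counterexample needs one concrete real field. *)
  apply: (@ereal_not_CRL Rdefinitions.R); apply: sub.
  by split; [exact: ereal_mCRL | exact: ereal_jCRL].
- by [].
(* [natdvd] settles the three remaining separations. *)
- split=> [d L []//|sub].
  by case: (sub _ _ natdvd_mCRL) => _ /natdvd_not_jCRL.
- by move=> eq; apply: natdvd_not_jCRL; apply/eq; exact: natdvd_mCRL.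
- by split=> // sub; apply: natdvd_not_jCRL; exact: sub.
Qed.
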